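(* Let $\{P_j\}_{j\in\mathbb{N}_0}$ be a system of selfadjoint projections in a Hilbert space $\mathscr{H}$, and for $n\in\mathbb{N}_0$ set $T_n=(1-P_n)(1-P_{n-1})\cdots(1-P_0)$, and $Q_n=P_n(1-P_{n-1})\cdots(1-P_0)$ with $Q_0=P_0$. The following are equivalent: (i) $1=\sum_{j\in\mathbb{N}_0}Q_j^*Q_j$ in the weak operator topology. (ii) $1=\sum_{j\in\mathbb{N}_0}Q_j$ in the strong operator topology. (iii) $T_n\to 0$ in the strong operator topology.
   Context: $\mathbb{N}_0=\{0,1,2,\dots\}$. A selfadjoint projection is an operator $P$ on $\mathscr{H}$ with $P=P^*=P^2$; $1$ denotes the identity operator. For bounded operators $A_n$ on $\mathscr{H}$: $A_n\to0$ in the strong operator topology iff $\lim_n\|A_nx\|=0$ for all $x\in\mathscr{H}$; $A_n\to 0$ in the weak operator topology iff $\lim_n\langle x,A_ny\rangle=0$ for all $x,y\in\mathscr{H}$. An infinite sum of operators equals $1$ in a given topology if the differences between $1$ and its partial sums $\sum_{j=0}^n$ tend to $0$ in that topology. *)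

(* Defs.v *)
From HB Require Import structures.
From mathcomp Require Import all_boot all_order all_algebra sesquilinear.
From mathcomp Require Import all_classical all_reals all_analysis.
From mathcomp Require Import complex.
Import Order.TTheory GRing.Theory Num.Theory.
Import numFieldNormedType.Exports.

Set Implicit Arguments.
Unset Strict Implicit.
Unset Printing Implicit Defensive.

Local Open Scope classical_set_scope.
Local Open Scope ring_scope.

(* Hilbert spaces may be real or complex: the scalar field is R or R[i]. *)
Variant scalar_kind := RealScalars | ComplexScalars.

Definition scalars (R : realType) (k : scalar_kind) : numFieldType :=
  match k with
  | RealScalars => R
  | ComplexScalars => R[i]
  end.

Definition scalar_conj (R : realType) (k : scalar_kind) :
    scalars R k -> scalars R k :=
  match k return scalars R k -> scalars R k with
  | RealScalars => idfun
  | ComplexScalars => @conjc R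
  end.
Arguments scalar_conj : clear implicits.

(* A Hilbert space over K is a complete normed K-module together with an inner
   product that induces its norm. The library's inner products are linear in
   their first argument. *)
Definition induces_norm (K : numFieldType) (theta : K -> K)
    (H : normedModType K) (dot : {dot H for theta}) : Prop :=
  forall x : H, `|x| ^+ 2 = dot x x.

Section Operators.
Context {K : numFieldType} {theta : K -> K} {H : normedModType K}.
Variable dot : {dot H for theta}.
Implicit Types (A B P : H -> H) (S : nat -> H -> H).

Definition bounded_operator A : Prop :=
  linear A /\ exists M : K, forall x, `|A x| <= M * `|x|.

Definition is_adjoint A B : Prop := forall x y, dot (A x) y = dot x (B y).

(* There is at most one B with [is_adjoint A B]; when H is a Hilbert space and A
   a bounded operator, it exists by the Riesz representation theorem. *)
Definition adjoint A : H -> H := xget \0 [set B | is_adjoint A B].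

Definition selfadjoint_projection P : Prop :=
  [/\ bounded_operator P, P = adjoint P & P = P \o P].

Definition sot_cvg0 S : Prop :=
  forall x, `|S n x| @[n --> \oo] --> (0 : K).

Definition wot_cvg0 S : Prop :=
  forall x y, dot x (S n y) @[n --> \oo] --> (0 : K).

Definition sot_sum1 S : Prop :=
  sot_cvg0 (fun n => idfun \- \sum_(0 <= j < n.+1) S j).

Definition wot_sum1 S : Prop :=
  wot_cvg0 (fun n => idfun \- \sum_(0 <= j < n.+1) S j).

End Operators.

Section Products.
Context {K : numFieldType} {H : normedModType K}.
Variable P : nat -> H -> H.

Fixpoint Tprod (n : nat) : H -> H :=
  match n with
  | 0%N => idfun \- P 0%N
  | m.+1 => (idfun \- P m.+1) \o Tprod m
  end.

Definition Qprod (n : nat) : H -> H :=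
  match n with
  | 0%N => P 0%N
  | m.+1 => P m.+1 \o Tprod m
  end.

End Products.

(* Main.v *)
Require Import Defs.
From HB Require Import structures.
From mathcomp Require Import all_boot all_order all_algebra sesquilinear.
From mathcomp Require Import all_classical all_reals all_analysis.
From mathcomp Require Import complex ring.
Import Order.TTheory GRing.Theory Num.Theory.
Import numFieldNormedType.Exports.

Set Implicit Arguments.
Unset Strict Implicit.
Unset Printing Implicit Defensive.

Local Open Scope classical_set_scope.
Local Open Scope ring_scope.

(** Two telescoping sums carry the proof.  Since [T_n = T_(n-1) - Q_n], the
    partial sums of the [Q_j] satisfy [1 - \sum_(j <= n) Q_j = T_n]
    ([sub_sum_Qprod]), so (ii) and (iii) speak of the same sequence of
    operators.  Since [P_n] is a selfadjoint idempotent, the vector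
    [u = T_(n-1) x] splits orthogonally into [P_n u = Q_n x] and
    [u - P_n u = T_n x]; the polarized form of Pythagoras' identity then gives
    [Q_n^* Q_n = T_(n-1)^* T_(n-1) - T_n^* T_n], whence
    [1 - \sum_(j <= n) Q_j^* Q_j = T_n^* T_n] ([dot_sub_sum_adjoint_Qprod]).

    Thus (i) says that [<T_n x, T_n y>] tends to [0] for all [x] and [y].
    Taking [y = x] gives [`|T_n x| ^+ 2 --> 0], which is (iii); conversely (iii)
    implies (i) because [`|<T_n x, T_n y>| <= `|T_n x| * `|T_n y|] by the
    Cauchy-Schwarz inequality.  *)

Section InnerProduct.
Context {K : numFieldType} {theta : K -> K} {H : normedModType K}.
Variable dot : {dot H for theta}.
Hypothesis dot_norm : induces_norm dot.

Let dotC u v : dot u v = theta (dot v u).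
Proof. by have := @hermitian_subproof _ _ _ _ dot u v; rewrite expr0 mul1r. Qed.

(* The linearity lemmas of [dot] seen as a mere bilinear map rewrite it into
   that weaker structure; these versions keep the syntactic form [dot u v]. *)
Let dotZl a u v : dot (a *: u) v = a * dot u v.
Proof. exact: (linearZl_LR dot). Qed.

Let dotZr a u v : dot u (a *: v) = theta a * dot u v.
Proof. exact: (linearZr_LR dot). Qed.

Let dotBl u v w : dot (u - v) w = dot u w - dot v w.
Proof. exact: (linearBl dot). Qed.

Let dotBr u v w : dot u (v - w) = dot u v - dot u w.
Proof. exact: (linearBr dot). Qed.

Let dot_sumr u n (F : nat -> H) :
  dot u (\sum_(0 <= j < n) F j) = \sum_(0 <= j < n) dot u (F j).
Proof. exact: (linear_sumr dot). Qed.

(** Homogeneity of the norm forces [theta] to behave as a conjugation: compare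
    the two values [`|c *: x| ^+ 2] and [dot (c *: x) (c *: x)]. *)
Lemma mul_theta (x : H) (c : K) : x != 0 -> c * theta c = `|c| ^+ 2.
Proof.
move=> x0; have x2_neq0 : `|x| ^+ 2 != 0 by rewrite expf_neq0 ?normr_eq0.
apply: (mulIf x2_neq0); rewrite -[RHS]exprMn -normrZ !dot_norm dotZl dotZr.
exact/esym/mulrA.
Qed.

Lemma norm_dot_le (x y : H) : `|dot x y| <= `|x| * `|y|.
Proof.
have [->|y0] := eqVneq y 0; first by rewrite (linear0r dot) !normr0 mulr0.
set s := dot x y; set t := `|y| ^+ 2.
have t_gt0 : 0 < t by rewrite exprn_gt0 ?normr_gt0.
have theta_t : theta t = t.
  by apply: (mulfI (lt0r_neq0 t_gt0)); rewrite (mul_theta _ y0) ger0_norm ?ltW.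
(* The component of [x] orthogonal to [y], scaled by [t] to avoid division, has
   nonnegative squared norm. *)
have : 0 <= `|t *: x - s *: y| ^+ 2 by rewrite exprn_ge0.
have -> : `|t *: x - s *: y| ^+ 2 = t * ((`|x| * `|y|) ^+ 2 - `|s| ^+ 2).
  rewrite dot_norm !(dotBl, dotBr) !dotZl !dotZr theta_t.
  rewrite (dotC y x) -/s -!dot_norm -/t -(mul_theta s y0) exprMn -/t.
  by ring.
by rewrite pmulr_rge0 // subr_ge0 ler_sqr ?nnegrE ?mulr_ge0.
Qed.

Lemma is_adjoint_adjoint (A B : H -> H) :
  is_adjoint dot A B -> is_adjoint dot A (adjoint dot A).
Proof. by move=> AB; apply: (xgetPex \0); exists B. Qed.

Lemma is_adjoint_id : is_adjoint dot idfun idfun.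
Proof. by []. Qed.

Lemma is_adjoint_sub (A A' B B' : H -> H) :
  is_adjoint dot A A' -> is_adjoint dot B B' ->
  is_adjoint dot (A \- B) (A' \- B').
Proof.
move=> AA' BB' x y.
by rewrite /= dotBl dotBr AA' BB'.
Qed.

Lemma is_adjoint_comp (A A' B B' : H -> H) :
  is_adjoint dot A A' -> is_adjoint dot B B' ->
  is_adjoint dot (A \o B) (B' \o A').
Proof. by move=> AA' BB' x y; rewrite /= AA' BB'. Qed.

(** The default value of [adjoint] does no harm here: if [P] had no adjoint,
    then [P = adjoint dot P] would be the zero map, which is its own adjoint. *)
Lemma selfadjoint_projection_adjoint (P : H -> H) :
  selfadjoint_projection dot P -> is_adjoint dot P P.
Proof.
case=> _ Padj _.
have [adjP|noAdj] := pselect (exists B, is_adjoint dot P B).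
  by case: adjP => B /is_adjoint_adjoint; rewrite -Padj.
have -> : P = \0.
  by rewrite Padj; apply: xgetPN => B PB; apply: noAdj; exists B.
by move=> x y; rewrite /= (linear0l dot) (linear0r dot).
Qed.

(** Polarized Pythagoras: the cross terms between [P x] and [y - P y] vanish. *)
Lemma dot_projection (P : H -> H) (x y : H) : selfadjoint_projection dot P ->
  dot (P x) (P y) = dot x y - dot (x - P x) (y - P y).
Proof.
move=> Pproj; have PP := selfadjoint_projection_adjoint Pproj.
have PxPy : dot (P x) (P y) = dot x (P y).
  by case: Pproj => _ _ Pidem; rewrite PP -[P (P y)]/((P \o P) y) -Pidem.
rewrite !(dotBl, dotBr) PxPy (PP x y).
by ring.
Qed.

Section Projections.
Variable P : nat -> H -> H.
Hypothesis P_proj : forall j, selfadjoint_projection dot (P j).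

Lemma sub_sum_Qprod n : idfun \- \sum_(0 <= j < n.+1) Qprod P j = Tprod P n.
Proof.
elim: n => [|n IHn]; first by rewrite big_nat1.
apply/funext => x; rewrite big_nat_recr //= -IHn /=.
by rewrite !fctE opprD addrA.
Qed.

(** [adjoint] is a default value unless an adjoint exists, so one is needed for
    [Qprod]; composing the factors in reverse order gives it explicitly. *)
Lemma Tprod_has_adjoint n : exists B, is_adjoint dot (Tprod P n) B.
Proof.
have idP j := is_adjoint_sub is_adjoint_id
                (selfadjoint_projection_adjoint (P_proj j)).
elim: n => [|n [B TB]]; first by exists (idfun \- P 0%N); apply: idP.
by exists (B \o (idfun \- P n.+1)); apply: is_adjoint_comp (idP _) TB.
Qed.

Lemma Qprod_adjoint n :
  is_adjoint dot (Qprod P n) (adjoint dot (Qprod P n)).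
Proof.
have PP j := selfadjoint_projection_adjoint (P_proj j).
case: n => [|n]; first exact: (is_adjoint_adjoint (PP 0%N)).
have [B TB] := Tprod_has_adjoint n.
exact: (is_adjoint_adjoint (is_adjoint_comp (PP n.+1) TB)).
Qed.

(** The sum telescopes: by [dot_projection] for [P_j] at [T_(j-1) x] and
    [T_(j-1) y], the [j]-th term [dot (Q_j x) (Q_j y)] is the decrease from
    [dot (T_(j-1) x) (T_(j-1) y)] to [dot (T_j x) (T_j y)], with [T_(-1) = 1]. *)
Lemma dot_sub_sum_adjoint_Qprod n (x y : H) :
  dot x ((idfun \-
    \sum_(0 <= j < n.+1) (adjoint dot (Qprod P j) \o Qprod P j)) y)
  = dot (Tprod P n x) (Tprod P n y).
Proof.
rewrite /= fct_sumE dotBr dot_sumr.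
elim: n => [|n IHn].
  rewrite big_nat1 -(Qprod_adjoint 0%N) (dot_projection _ _ (P_proj 0)).
  by rewrite opprB addrC subrK.
rewrite big_nat_recr // opprD addrA IHn -(Qprod_adjoint n.+1) /=
  (dot_projection _ _ (P_proj n.+1)).
by rewrite opprB addrC subrK.
Qed.

End Projections.

End InnerProduct.

Theorem corollary3p8 (R : realType) (k : scalar_kind)
  (H : completeNormedModType (scalars R k))
  (dot : {dot H for scalar_conj R k})
  (dot_norm : induces_norm dot)
  (P : nat -> H -> H)
  (P_proj : forall j : nat, selfadjoint_projection dot (P j)) :
  [<-> wot_sum1 dot (fun j => adjoint dot (Qprod P j) \o Qprod P j);
       sot_sum1 (Qprod P);
       sot_cvg0 (Tprod P)].
Proof.
have sum_Q : (fun n => idfun \- \sum_(0 <= j < n.+1) Qprod P j) = Tprod P.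
  by apply/funext => n; apply: sub_sum_Qprod.
tfae.
- move=> wot; rewrite /sot_sum1 sum_Q => x.
  apply/cvgr0Pnorm_lt => e e_gt0.
  have /cvgr0_norm_lt/(_ _ (exprn_gt0 2 e_gt0)) := wot x x.
  apply: filterS => n.
  rewrite dot_sub_sum_adjoint_Qprod // -dot_norm normrX normr_id.
  by rewrite ltr_sqr ?nnegrE ?normr_ge0 ?ltW.
- by rewrite /sot_sum1 sum_Q.
- move=> T0 x y; apply: norm_cvg0.
  have Txy0 : `|Tprod P n x| * `|Tprod P n y| @[n --> \oo] --> (0 : scalars R k).
    by rewrite -(mulr0 0); apply: cvgM; apply: T0.
  apply/cvgr0Pnorm_lt => e e_gt0.
  have /cvgr0_norm_lt/(_ _ e_gt0) := Txy0.
  apply: filterS => n; apply: le_lt_trans.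
  rewrite dot_sub_sum_adjoint_Qprod // normr_id normrM !normr_id.
  exact: norm_dot_le.
Qed.
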